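(* Let $\mathbb{A}$ be a Nelson algebra. Then there exist a set $U$ and a quasiorder $R$ on $U$ such that $\mathbb{A}$ is isomorphic to a subalgebra of the rough set Nelson algebra $\mathbb{RS}$ determined by $R$.
   Context: A Nelson algebra is a structure $\mathbb{A}=(A,\vee,\wedge,\rightarrow,{\sim},0,1)$ such that $(A,\vee,\wedge,0,1)$ is a bounded distributive lattice and for all $a,b,c\in A$: (N1) ${\sim}{\sim}a=a$; (N2) $a\le b$ if and only if ${\sim}b\le{\sim}a$; (N3) $a\wedge{\sim}a\le b\vee{\sim}b$; (N4) $a\wedge c\le({\sim}a)\vee b$ if and only if $c\le a\rightarrow b$; (N5) $(a\wedge b)\rightarrow c=a\rightarrow(b\rightarrow c)$. Isomorphisms and subalgebras are taken with respect to all the operations $\vee,\wedge,\rightarrow,{\sim},0,1$. A quasiorder on a set $U$ is a reflexive and transitive binary relation $R\subseteq U\times U$. For $x\in U$ put $R(x)=\{y\in U\mid x\,R\,y\}$. For $X\subseteq U$, the lower approximation is $X^{\blacktriangledown}=\{x\in U\mid R(x)\subseteq X\}$, the upper approximation is $X^{\blacktriangle}=\{x\in U\mid R(x)\cap X\neq\emptyset\}$, and $-X=U\setminus X$. Let $\mathit{RS}=\{(X^{\blacktriangledown},X^{\blacktriangle})\mid X\subseteq U\}$, ordered coordinatewise by inclusion. When $R$ is a quasiorder, it is known that $\mathit{RS}$ is closed under the following operations and forms with them a Nelson algebra, denoted $\mathbb{RS}$ (the rough set Nelson algebra determined by $R$), with $0=(\emptyset,\emptyset)$ and $1=(U,U)$: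 $(X^{\blacktriangledown},X^{\blacktriangle})\vee(Y^{\blacktriangledown},Y^{\blacktriangle})=(X^{\blacktriangledown}\cup Y^{\blacktriangledown},X^{\blacktriangle}\cup Y^{\blacktriangle})$; $(X^{\blacktriangledown},X^{\blacktriangle})\wedge(Y^{\blacktriangledown},Y^{\blacktriangle})=(X^{\blacktriangledown}\cap Y^{\blacktriangledown},X^{\blacktriangle}\cap Y^{\blacktriangle})$; ${\sim}(X^{\blacktriangledown},X^{\blacktriangle})=(-X^{\blacktriangle},-X^{\blacktriangledown})$; $(X^{\blacktriangledown},X^{\blacktriangle})\rightarrow(Y^{\blacktriangledown},Y^{\blacktriangle})=\big((-X^{\blacktriangledown}\cup Y^{\blacktriangledown})^{\blacktriangledown},\,-X^{\blacktriangledown}\cup Y^{\blacktriangle}\big)$. Here $-X^{\blacktriangle}$ means $U\setminus(X^{\blacktriangle})$ and $-X^{\blacktriangledown}$ means $U\setminus(X^{\blacktriangledown})$. *)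

(* Defs.v *)
From HB Require Import structures.
From mathcomp Require Import all_boot all_order.
From mathcomp Require Import boolp classical_sets functions.

Set Implicit Arguments.
Unset Strict Implicit.
Unset Printing Implicit Defensive.

Import Order.TTheory.

Local Open Scope order_scope.
Local Open Scope classical_set_scope.

(* A [tbDistrLatticeType] may be trivial ([\bot] and [\top] may coincide). *)
HB.mixin Record isNelson d A of Order.TBDistrLattice d A := {
  nneg : A -> A;
  nimp : A -> A -> A;
  nnegK : forall a : A, nneg (nneg a) = a;
  le_nneg : forall a b : A, (a <= b) = (nneg b <= nneg a);
  nkleene : forall a b : A, (a `&` nneg a <= b `|` nneg b)%O;
  nimpP : forall a b c : A,
    (a `&` c <= nneg a `|` b)%O = (c <= nimp a b);
  nimp_curry : forall a b c : A,
    nimp (a `&` b)%O c = nimp a (nimp b c);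
}.

#[short(type="nelsonType")]
HB.structure Definition Nelson d :=
  { A of isNelson d A & Order.TBDistrLattice d A }.

Record nelson_subalgebra d (B : nelsonType d) (S : set B) : Prop := {
  nelson_sub0 : S \bot;
  nelson_sub1 : S \top;
  nelson_subU : forall a b, S a -> S b -> S (a `|` b)%O;
  nelson_subI : forall a b, S a -> S b -> S (a `&` b)%O;
  nelson_subN : forall a, S a -> S (nneg a);
  nelson_subimp : forall a b, S a -> S b -> S (nimp a b);
}.

Record nelson_morphism dA dB (A : nelsonType dA) (B : nelsonType dB)
    (f : A -> B) : Prop := {
  nelson_mor0 : f \bot = \bot;
  nelson_mor1 : f \top = \top;
  nelson_morU : forall a b, f (a `|` b)%O = (f a `|` f b)%O;
  nelson_morI : forall a b, f (a `&` b)%O = (f a `&` f b)%O;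
  nelson_morN : forall a, f (nneg a) = nneg (f a);
  nelson_morimp : forall a b, f (nimp a b) = nimp (f a) (f b);
}.

Definition nelson_isomorphic_to_sub dA dB (A : nelsonType dA)
    (B : nelsonType dB) (S : set B) : Prop :=
  exists f : A -> B, set_bij [set: A] S f /\ nelson_morphism f.

Record quasiorder (U : Type) := Quasiorder {
  qo_rel :> U -> set U;
  qo_refl : forall x, qo_rel x x;
  qo_trans : forall x y z, qo_rel x y -> qo_rel y z -> qo_rel x z;
}.

Section Approximations.
Context {U : Type} (R : quasiorder U).
Implicit Types (A B X : set U) (p : set U * set U).

Definition lower X : set U := [set x | R x `<=` X].
Definition upper X : set U := [set x | R x `&` X !=set0].

Definition is_rough p : Prop := exists X, p = (lower X, upper X).

(* An up-closed set in which every element has a successor other than itself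
   contains two disjoint cofinal subsets (by Zorn's lemma). *)
Lemma cofinal_split (E : set U) :
  (forall x y, E x -> R x y -> E y) ->
  (forall x, E x -> exists2 y, R x y & y <> x) ->
  exists P Q : set U, [/\ P `<=` E, Q `<=` E, P `&` Q = set0,
    (forall x, E x -> exists2 y, R x y & P y) &
    (forall x, E x -> exists2 y, R x y & Q y)].
Proof.
move=> Eup Ens.
pose good (W : set (U * bool)) :=
  [/\ forall x b, W (x, b) -> E x,
      forall x, W (x, true) -> W (x, false) -> False &
      forall x b, W (x, b) -> exists2 y, R x y & W (y, ~~ b)].
have [|W [[WE Wd Wa] Wmax]] := @Zorn_bigcup _ good.
  move=> F Fg Ft; split.
  - by move=> x b [X FX Xx]; have [h _ _] := Fg _ FX; exact: h Xx.
  - move=> x [X FX Xx] [Y FY Yx].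
    have [_ hX _] := Fg _ FX; have [_ hY _] := Fg _ FY.
    by have [XY|YX] := Ft _ _ FX FY; [exact: hY (XY _ Xx) Yx
      | exact: hX Xx (YX _ Yx)].
  - move=> x b [X FX Xx]; have [_ _ h] := Fg _ FX.
    by have [y xy Xy] := h _ _ Xx; exists y => //; exists X.
have WV V : good V -> (forall x b, V (x, b) -> forall c, ~ W (x, c)) ->
    forall x b, ~ V (x, b).
  move=> [VE Vd Va] VW x b Vx; apply: (Wmax (W `|` V)).
    split; first exact: subsetUl.
    by move=> /(_ (x, b) (or_intror Vx)); exact: VW Vx b.
  split.
  - by move=> y c [/WE|/VE].
  - move=> y [Wy|Vy] [Wy'|Vy'].
    + exact: Wd Wy Wy'.
    + exact: VW Vy' _ Wy.
    + exact: VW Vy _ Wy'.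
    + exact: Vd Vy Vy'.
  - by move=> y c [/Wa|/Va] [z yz Wz]; exists z => //; [left|right].
have dense x : E x -> exists y b, R x y /\ W (y, b).
  move=> Ex; apply: contrapT => nW.
  have nW' y : R x y -> forall b, ~ W (y, b).
    by move=> xy b Wy; apply: nW; exists y, b.
  have [[y [z [xy yz zy nzy]]]|nc] :=
      pselect (exists y z, [/\ R x y, R y z, R z y & z <> y]).
    apply: (WV [set p | p = (y, true) \/ p = (z, false)] _ _ y true);
      last by left.
    - split.
      + move=> t c [] [-> _]; apply: Eup Ex _ => //.
        exact: qo_trans xy yz.
      + by move=> t [[->]|[_ //]] [[//]|[e]]; exact: nzy.
      + move=> t c [] [-> ->] /=.
          by exists z => //; right.
        by exists y => //; left.
    - move=> t c [] [-> _]; apply: nW' => //.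
      exact: qo_trans xy yz.
  have /choice[g gP] : forall y, exists z, R x y -> R y z /\ z <> y.
    move=> y; have [xy|nxy] := pselect (R x y); last by exists y.
    by have [z yz nzy] := Ens _ (Eup _ _ Ex xy); exists z.
  pose u n := iter n g x.
  have xu n : R x (u n).
    elim: n => [|n IH]; first exact: qo_refl.
    exact: qo_trans IH (gP _ IH).1.
  have uR n m : (n <= m)%N -> R (u n) (u m).
    move=> /subnK <-; elim: (m - n)%N => [|k IH]; first exact: qo_refl.
    exact: qo_trans IH (gP _ (xu _)).1.
  have ulti n m : (n < m)%N -> u n <> u m.
    move=> nm e; apply: nc; exists (u n), (u n.+1).
    have [h1 h2] := gP _ (xu n).
    by split => //; rewrite e; exact: uR.
  apply: (WV [set p | exists n, p = (u n, odd n)] _ _ (u 0%N) false);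
    last by exists 0%N.
  - split.
    + by move=> t c [n [-> _]]; exact: Eup Ex (xu n).
    + move=> t [n [-> on]] [m [e om]].
      have [nm|mn|nm] := ltngtP n m.
      * exact: ulti _ _ nm e.
      * exact: ulti _ _ mn (esym e).
      * by move: on; rewrite nm -om.
    + move=> t c [n [-> ->]]; exists (u n.+1); first exact: uR.
      by exists n.+1.
  - by move=> t c [n [-> _]]; exact: nW'.
have cofin b x : E x -> exists2 y, R x y & W (y, b).
  move=> Ex; have [y [c [xy Wy]]] := dense _ Ex.
  have [->|nbc] := eqVneq b c; first by exists y.
  have [z yz Wz] := Wa _ _ Wy; exists z; first exact: qo_trans xy yz.
  by have -> : b = ~~ c by case: b c nbc {Wy Wz} => [] [].
exists [set x | W (x, true)], [set x | W (x, false)]; split.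
- by move=> x; exact: WE.
- by move=> x; exact: WE.
- by rewrite -subset0 => x [/Wd] h /h.
- exact: cofin.
- exact: cofin.
Qed.

(* The last condition: an element whose only successor is itself lies in the
   upper approximation of a set only if it lies in the lower one. *)
Lemma is_roughP A B :
  is_rough (A, B) <->
  [/\ forall x y, A x -> R x y -> A y,
      forall x y, B y -> R x y -> B x,
      A `<=` B &
      forall x, R x `<=` [set x] -> B x -> A x].
Proof.
split=> [[X [-> ->]]|[Aup Bdown AB sing]].
  split.
  - by move=> x y Xx xy z yz; apply: Xx; exact: qo_trans xy yz.
  - move=> x y [z [yz Xz]] xy; exists z; split => //.
    exact: qo_trans xy yz.
  - by move=> x Xx; exists x; split; [exact: qo_refl|apply: Xx; exact: qo_refl].
  - by move=> x Rx [y [/Rx -> Xx]] z /Rx ->.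
pose C := B `\` A.
pose E := [set x | R x `<=` C].
have EC x : E x -> C x by apply; exact: qo_refl.
have [|x Ex|P [Q [PE QE PQ0 Pc Qc]]] := @cofinal_split E.
- by move=> x y Ex xy z yz; apply: Ex; exact: qo_trans xy yz.
- apply: contrapT => n; have [Bx nAx] := EC _ Ex; apply/nAx/sing => //.
  by move=> y xy /=; apply: contrapT => nyx; apply: n; exists y.
pose X := [set x | [\/ A x, C x /\ (exists2 y, R x y & ~ B y) | P x]].
exists X; congr pair; apply/seteqP; split => x.
- by move=> Ax y xy; apply: Or31; exact: Aup Ax xy.
- move=> RX; apply: contrapT => nAx.
  have Bx y : R x y -> B y by move=> /RX[/AB //|[[]] //|/PE/EC[]].
  have xx := qo_refl R x.
  have Cx : C x by split => //; exact: Bx.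
  have Px : P x.
    case: (RX _ xx) => // [[_ [y xy nBy]]].
    by case: nBy; exact: Bx.
  have [y xy Qy] := Qc _ (PE _ Px).
  case: (RX _ xy) => [Ay|[_ [z yz nBz]]|Py].
  + by have [_] := EC _ (QE _ Qy).
  + by apply/nBz/Bx; exact: qo_trans xy yz.
  + by have : (P `&` Q) y by []; rewrite PQ0.
- move=> Bx; have [Ax|nAx] := pselect (A x).
    by exists x; split; [exact: qo_refl|exact: Or31].
  have Cx : C x by [].
  have [[y xy Ay]|nA] := pselect (exists2 y, R x y & A y).
    by exists y; split => //; exact: Or31.
  have [nB|nB] := pselect (exists2 y, R x y & ~ B y).
    by exists x; split; [exact: qo_refl|exact: Or32].
  have Ex : E x.
    move=> y xy; split; last by move=> Ay; apply: nA; exists y.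
    by apply: contrapT => nBy; apply: nB; exists y.
  by have [y xy Py] := Pc _ Ex; exists y; split => //; exact: Or33.
- move=> [y [xy Xy]]; apply: Bdown xy.
  by case: Xy => [/AB //|[[]] //|/PE/EC[]].
Qed.

End Approximations.

Record RS (U : Type) (R : quasiorder U) := MkRS {
  rs_val : set U * set U;
  rs_valP : `[< is_rough R rs_val >];
}.

Section RoughSetAlgebra.
Context {U : Type} (R : quasiorder U).
Implicit Types p q r : RS R.

HB.instance Definition _ := [isSub for @rs_val U R].
HB.instance Definition _ := [Choice of RS R by <:].

Definition rs_le p q : bool :=
  `[< (rs_val p).1 `<=` (rs_val q).1 /\ (rs_val p).2 `<=` (rs_val q).2 >].

Definition rs_join_val p q : set U * set U :=
  ((rs_val p).1 `|` (rs_val q).1, (rs_val p).2 `|` (rs_val q).2).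

Definition rs_meet_val p q : set U * set U :=
  ((rs_val p).1 `&` (rs_val q).1, (rs_val p).2 `&` (rs_val q).2).

Definition rs_neg_val p : set U * set U := (~` (rs_val p).2, ~` (rs_val p).1).

Definition rs_imp_val p q : set U * set U :=
  (lower R (~` (rs_val p).1 `|` (rs_val q).1),
   ~` (rs_val p).1 `|` (rs_val q).2).

Lemma rs_eq p q : (rs_val p).1 = (rs_val q).1 ->
  (rs_val p).2 = (rs_val q).2 -> p = q.
Proof.
move=> e1 e2; apply: val_inj.
by rewrite [LHS]surjective_pairing e1 e2 -surjective_pairing.
Qed.

Lemma rs_rough p : is_rough R ((rs_val p).1, (rs_val p).2).
Proof. by case: p => -[A B] /= /asboolP. Qed.

Lemma rs_bot_subproof : `[< is_rough R (set0, set0) >].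
Proof. by apply/asboolP/is_roughP; split. Qed.

Lemma rs_top_subproof : `[< is_rough R (setT, setT) >].
Proof. by apply/asboolP/is_roughP; split. Qed.

Lemma rs_join_subproof p q : `[< is_rough R (rs_join_val p q) >].
Proof.
have /is_roughP[pU pD pS p1] := rs_rough p.
have /is_roughP[qU qD qS q1] := rs_rough q.
apply/asboolP/is_roughP; split.
- by move=> x y [px|qx] xy; [left; exact: pU px xy|right; exact: qU qx xy].
- by move=> x y [px|qx] xy; [left; exact: pD px xy|right; exact: qD qx xy].
- by move=> x [/pS|/qS]; [left|right].
- by move=> x xx [/(p1 _ xx)|/(q1 _ xx)]; [left|right].
Qed.

Lemma rs_meet_subproof p q : `[< is_rough R (rs_meet_val p q) >].
Proof.
have /is_roughP[pU pD pS p1] := rs_rough p.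
have /is_roughP[qU qD qS q1] := rs_rough q.
apply/asboolP/is_roughP; split.
- by move=> x y [px qx] xy; split; [exact: pU px xy|exact: qU qx xy].
- by move=> x y [px qx] xy; split; [exact: pD px xy|exact: qD qx xy].
- by move=> x [/pS px /qS qx].
- by move=> x xx [/(p1 _ xx) px /(q1 _ xx) qx].
Qed.

Lemma rs_neg_subproof p : `[< is_rough R (rs_neg_val p) >].
Proof.
have /is_roughP[pU pD pS p1] := rs_rough p.
apply/asboolP/is_roughP; split.
- by move=> x y npx xy py; apply: npx; exact: pD py xy.
- by move=> x y npy xy px; apply: npy; exact: pU px xy.
- by move=> x npx /pS.
- by move=> x xx npx /(p1 _ xx).
Qed.

Lemma rs_imp_subproof p q : `[< is_rough R (rs_imp_val p q) >].
Proof.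
have /is_roughP[pU pD pS p1] := rs_rough p.
have /is_roughP[qU qD qS q1] := rs_rough q.
apply/asboolP/is_roughP; split.
- by move=> x y h xy z yz; apply: h; exact: qo_trans xy yz.
- move=> x y [npy|qy] xy; last by right; exact: qD qy xy.
  by left => px; apply: npy; exact: pU px xy.
- by move=> x /(_ _ (qo_refl R x)) [|/qS]; [left|right].
- by move=> x xx [npx|/(q1 _ xx) qx] y /xx ->; [left|right].
Qed.

Definition rs_bot : RS R := MkRS rs_bot_subproof.
Definition rs_top : RS R := MkRS rs_top_subproof.
Definition rs_join p q : RS R := MkRS (rs_join_subproof p q).
Definition rs_meet p q : RS R := MkRS (rs_meet_subproof p q).
Definition rs_neg p : RS R := MkRS (rs_neg_subproof p).
Definition rs_imp p q : RS R := MkRS (rs_imp_subproof p q).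

Lemma rs_leP p q : reflect
  ((rs_val p).1 `<=` (rs_val q).1 /\ (rs_val p).2 `<=` (rs_val q).2)
  (rs_le p q).
Proof. exact: asboolP. Qed.

Lemma rs_le_refl : reflexive rs_le.
Proof. by move=> p; apply/rs_leP; split. Qed.

Lemma rs_le_anti : antisymmetric rs_le.
Proof.
by move=> p q /andP[/rs_leP[? ?] /rs_leP[? ?]]; apply: rs_eq; exact/seteqP.
Qed.

Lemma rs_le_trans : transitive rs_le.
Proof.
move=> q p r /rs_leP[pq1 pq2] /rs_leP[qr1 qr2]; apply/rs_leP.
by split; [exact: subset_trans qr1|exact: subset_trans qr2].
Qed.

Lemma rs_meetP p q r : rs_le p (rs_meet q r) = rs_le p q && rs_le p r.
Proof.
apply/rs_leP/andP => [[/= h1 h2]|[/rs_leP[? ?] /rs_leP[? ?]]].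
  by split; apply/rs_leP; split=> x; [move=> /h1[]|move=> /h2[]
    |move=> /h1[]|move=> /h2[]].
by split; rewrite /= subsetI; split.
Qed.

Lemma rs_joinP p q r : rs_le (rs_join p q) r = rs_le p r && rs_le q r.
Proof.
apply/rs_leP/andP => [[/=]|[/rs_leP[? ?] /rs_leP[? ?]]].
  by rewrite !subUset => -[? ?] [? ?]; split; apply/rs_leP.
by split; rewrite /= subUset; split.
Qed.

Fact rs_display : Order.disp_t. Proof. exact: Order.Disp tt tt. Qed.

HB.instance Definition _ := Order.Le_isPOrder.Build rs_display (RS R)
  rs_le_refl rs_le_anti rs_le_trans.

HB.instance Definition _ := Order.POrder_MeetJoin_isLattice.Build
  rs_display (RS R) rs_meetP rs_joinP.

Lemma rs_meetUl : left_distributive rs_meet rs_join.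
Proof. by move=> p q r; apply: rs_eq; exact: setIUl. Qed.

HB.instance Definition _ := Order.Lattice_Meet_isDistrLattice.Build
  rs_display (RS R) rs_meetUl.

Lemma rs_le0x p : rs_le rs_bot p.
Proof. by apply/rs_leP; split; exact: sub0set. Qed.

Lemma rs_lex1 p : rs_le p rs_top.
Proof. by apply/rs_leP; split; exact: subsetT. Qed.

HB.instance Definition _ := Order.hasBottom.Build rs_display (RS R) rs_le0x.
HB.instance Definition _ := Order.hasTop.Build rs_display (RS R) rs_lex1.

Lemma rs_negK p : rs_neg (rs_neg p) = p.
Proof. by apply: rs_eq; rewrite /= setCK. Qed.

Lemma rs_le_neg p q : rs_le p q = rs_le (rs_neg q) (rs_neg p).
Proof.
apply/rs_leP/rs_leP => -[/= h1 h2]; split=> x /=.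
- by move=> nqx px; apply/nqx/h2.
- by move=> nqx px; apply/nqx/h1.
- by move=> px; apply: contrapT => nqx; exact: h2 nqx px.
- by move=> px; apply: contrapT => nqx; exact: h1 nqx px.
Qed.

Lemma rs_kleene p q : rs_le (rs_meet p (rs_neg p)) (rs_join q (rs_neg q)).
Proof.
have /is_roughP[_ _ pS _] := rs_rough p.
have /is_roughP[_ _ qS _] := rs_rough q.
apply/rs_leP; split=> x /= [h1 h2]; first by have := pS _ h1.
by have [/qS|] := pselect ((rs_val q).1 x); [left|right].
Qed.

Lemma rs_impP p q r :
  rs_le (rs_meet p r) (rs_join (rs_neg p) q) = rs_le r (rs_imp p q).
Proof.
have /is_roughP[pU pD pS p1] := rs_rough p.
have /is_roughP[qU qD qS q1] := rs_rough q.
have /is_roughP[rU rD rS r1] := rs_rough r.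
apply/rs_leP/rs_leP => -[/= h1 h2]; split=> x /=.
- move=> rx y xy; have [py|npy] := pselect ((rs_val p).1 y); last by left.
  have ry := rU _ _ rx xy; right.
  by have [npy|] := h1 _ (conj py ry) => //; have := pS _ py.
- move=> rx; have [px|npx] := pselect ((rs_val p).1 x); last by left.
  by right; have [] := h2 _ (conj (pS _ px) rx).
- move=> [px /h1 /(_ _ (qo_refl R x)) [//|qx]]; by right.
- by move=> [_ /h2].
Qed.

Lemma rs_imp_curry p q r :
  rs_imp (rs_meet p q) r = rs_imp p (rs_imp q r).
Proof.
have /is_roughP[pU _ _ _] := rs_rough p.
apply: rs_eq; rewrite /= ?setCI ?setUA//.
apply/seteqP; split=> x /= h y xy.
- have [py|npy] := pselect ((rs_val p).1 y); last by left.
  right=> z yz; have [[npz|nqz]|rz] := h _ (qo_trans xy yz).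
  + by case: npz; exact: pU py yz.
  + by left.
  + by right.
- have [npy|/(_ _ (qo_refl R y))[nqy|ry]] := h _ xy.
  + by left; left.
  + by left; right.
  + by right.
Qed.

HB.instance Definition _ := isNelson.Build rs_display (RS R)
  rs_negK rs_le_neg rs_kleene rs_impP rs_imp_curry.

End RoughSetAlgebra.

(* Main.v *)
(* Let [g P = {a | ~a \notin P}], an involution on prime filters; by (N3) [P]
   and [g P] are always comparable. The points of [U] are the prime filters
   with [P `<=` g P], each taken twice so that no point is its own only
   successor; rough sets are then all pairs (up-set, larger down-set). The
   embedding sends [a] to the pair of [{P | a \in P}] and [{P | a \in g P}]. *)
Require Import Defs.
From HB Require Import structures.
From mathcomp Require Import all_boot all_order.
From mathcomp Require Import boolp classical_sets functions.

Set Implicit Arguments.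
Unset Strict Implicit.
Unset Printing Implicit Defensive.

Import Order.TTheory.

Local Open Scope order_scope.
Local Open Scope classical_set_scope.

(** * Prime separation in bounded distributive lattices *)

Section PrimeFilters.
Context {d : Order.disp_t} {L : tbDistrLatticeType d}.
Implicit Types (x y : L) (F I P : set L).

Record is_filter F : Prop := {
  filter1 : F \top;
  filter_le : forall x y, F x -> x <= y -> F y;
  filterI : forall x y, F x -> F y -> F (x `&` y)%O;
}.

Record is_ideal I : Prop := {
  ideal0 : I \bot;
  ideal_le : forall x y, I y -> x <= y -> I x;
  idealU : forall x y, I x -> I y -> I (x `|` y)%O;
}.

Record is_prime_filter P : Prop := {
  prime_is_filter :> is_filter P;
  prime_proper : ~ P \bot;
  prime_or : forall x y, P (x `|` y)%O -> P x \/ P y;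
}.

(** When [F] is a filter, this is the filter generated by [F] and [x]. *)
Definition adjoin F x : set L := [set z | exists2 m, F m & (m `&` x)%O <= z].

Lemma adjoin_filter F x : is_filter F -> is_filter (adjoin F x).
Proof.
move=> Ff; split.
- by exists \top; [exact: filter1|exact: lex1].
- by move=> y z [m Fm my] yz; exists m => //; exact: le_trans yz.
- move=> y z [m Fm my] [n Fn nz]; exists (m `&` n)%O; first exact: filterI.
  by rewrite lexI (le_trans _ my) ?(le_trans _ nz) ?leI2 ?leIl ?leIr.
Qed.

Lemma sub_adjoin F x : F `<=` adjoin F x.
Proof. by move=> y Fy; exists y; rewrite ?leIl. Qed.

Lemma adjoin_mem F x : is_filter F -> adjoin F x x.
Proof. by move=> Ff; exists \top; [exact: filter1|exact: leIr]. Qed.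

(** Zorn's lemma gives a maximal filter [M] that contains [F] and misses [I]; it is prime because
    adjoining any element outside [M] yields a filter that meets [I]. *)
Lemma prime_separation F I : is_filter F -> is_ideal I -> F `&` I = set0 ->
  exists P, [/\ is_prime_filter P, F `<=` P & P `&` I = set0].
Proof.
move=> Ff Ii FI.
(* The empty set is admitted because it is the union of the empty chain. *)
pose good X := [/\ forall x, X x -> F `<=` X,
  forall x y, X x -> x <= y -> X y,
  forall x y, X x -> X y -> X (x `&` y)%O & forall x, X x -> ~ I x].
have good_filter X : is_filter X -> F `<=` X -> (forall x, X x -> ~ I x) ->
    good X.
  by move=> Xf FX XI; split => //; [exact: filter_le|exact: filterI].
have [|M [[FM Mle MI MnI] Mmax]] := @Zorn_bigcup _ good.
  move=> C Cg Ct; split.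
  - move=> x [X CX Xx] y Fy; exists X => //.
    by have [h _ _ _] := Cg _ CX; exact: h Xx _ Fy.
  - move=> x y [X CX Xx] xy; exists X => //.
    by have [_ h _ _] := Cg _ CX; exact: h Xx xy.
  - move=> x y [X CX Xx] [Y CY Yy].
    have [_ _ hX _] := Cg _ CX; have [_ _ hY _] := Cg _ CY.
    by have [XY|YX] := Ct _ _ CX CY;
      [exists Y => //; apply: hY => //; exact: XY
      |exists X => //; apply: hX => //; exact: YX].
  - by move=> x [X CX Xx]; have [_ _ _ h] := Cg _ CX; exact: h.
(* [F] is a nonempty admissible set, so the maximal set cannot be empty. *)
have M1 : M \top.
  apply: contrapT => nM1.
  have M0 x : ~ M x by move=> Mx; apply: nM1; exact: Mle Mx (lex1 x).
  apply: (Mmax F).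
    by split=> [x /M0 //|/(_ _ (filter1 Ff)) /M0].
  apply: good_filter => // x Fx Ix.
  by have : (F `&` I) x by []; rewrite FI.
have Mf : is_filter M by [].
have Madj x : ~ M x -> exists2 m, M m & I (m `&` x)%O.
  move=> nMx; apply: contrapT => nI; apply: (Mmax (adjoin M x)).
    split; first exact: sub_adjoin.
    by move=> /(_ _ (adjoin_mem x Mf)).
  apply: good_filter; first exact: adjoin_filter.
    by apply: subset_trans (FM _ M1) _; exact: sub_adjoin.
  move=> z [m Mm mz] Iz; apply: nI; exists m => //; exact: ideal_le Iz mz.
exists M; split; last first.
- by rewrite -subset0 => x [/MnI].
- exact: FM M1.
split => //; first by move=> /MnI; apply; exact: ideal0.
move=> x y Mxy; apply: contrapT => /not_orP[/Madj[m Mm Imx] /Madj[n Mn Iny]].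
(* By distributivity this meet lies below [(m ∧ x) ∨ (n ∧ y)], which is in [I]. *)
apply: (MnI _ (MI _ _ (MI _ _ Mm Mn) Mxy)).
apply: (ideal_le Ii (idealU Ii Imx Iny)).
by rewrite meetUr leU2 ?leI2 ?leIl ?leIr.
Qed.

End PrimeFilters.

(** * De Morgan laws and negative elements, those with [k <= ~k] *)

Section NelsonAlgebras.
Context {d : Order.disp_t} {A : nelsonType d}.
Implicit Types (a b k : A) (P Q : set A).

Lemma nneg_leC a b : (a <= nneg b) = (b <= nneg a).
Proof. by rewrite le_nneg nnegK. Qed.

Lemma nneg_geC a b : (nneg a <= b) = (nneg b <= a).
Proof. by rewrite le_nneg nnegK. Qed.

Lemma nneg0 : nneg \bot = \top :> A.
Proof. by apply/eqP; rewrite -le1x nneg_leC le0x. Qed.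

Lemma nneg1 : nneg \top = \bot :> A.
Proof. by rewrite -nneg0 nnegK. Qed.

Lemma nnegU a b : nneg (a `|` b)%O = (nneg a `&` nneg b)%O.
Proof.
apply/le_anti/andP; split.
  by rewrite lexI -!le_nneg leUl leUr.
by rewrite nneg_leC leUx !(nneg_leC _ (_ `&` _)%O) leIl leIr.
Qed.

Lemma nnegI a b : nneg (a `&` b)%O = (nneg a `|` nneg b)%O.
Proof. by rewrite -[RHS]nnegK nnegU !nnegK. Qed.

Lemma nimp_mp a b : (a `&` nimp a b <= nneg a `|` b)%O.
Proof. by rewrite nimpP. Qed.

Lemma le_nimp a b : b <= nimp a b.
Proof. by rewrite -nimpP leIxr// leUr. Qed.

Lemma nneg_le_nimp a b : nneg a <= nimp a b.
Proof. by rewrite -nimpP leIxr// leUl. Qed.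

Lemma negative_le_nneg a b : a <= nneg a -> b <= nneg b -> a <= nneg b.
Proof.
move=> an bn; have := nkleene a b.
by rewrite (meet_idPl an) (join_idPr bn).
Qed.

Lemma negativeU a b : a <= nneg a -> b <= nneg b ->
  (a `|` b)%O <= nneg (a `|` b)%O.
Proof.
move=> an bn; have ab := negative_le_nneg an bn.
by rewrite nnegU lexI !leUx an bn ab nneg_leC ab.
Qed.

(** Only the part [a ∧ k] of [a] needs work. By (N3), [k] is below
    [(b ∨ ~b) ∧ (b ∨ ~k) = b ∨ ~(b ∨ k)], and [~(b ∨ k) <= ~a]. *)
Lemma negative_absorb a b k : k <= nneg k -> a <= (b `|` k)%O ->
  a <= (nneg a `|` b)%O.
Proof.
move=> kn abk; rewrite -[leLHS](meet_idPl abk) meetUr leUx lexUr ?leIr//=.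
have kb : k <= (b `|` nneg b)%O.
  by rewrite -(meet_idPl kn); exact: nkleene.
apply: (@le_trans _ _ ((b `|` nneg b) `&` (b `|` nneg k))%O).
  by rewrite leIxr// lexI kb lexUr.
by rewrite -joinIr leUx leUr lexUl// -nnegU -le_nneg.
Qed.

(* A filter is consistent exactly when it contains no [k <= ~k], so a prime
   filter avoiding this ideal is a point of the representation missing [b]. *)
Definition negative_ideal b : set A :=
  [set x | exists2 k, k <= nneg k & x <= (b `|` k)%O].

Lemma negative_idealP b : is_ideal (negative_ideal b).
Proof.
split.
- by exists \bot; rewrite ?le0x.
- by move=> x y [k kn yk] xy; exists k => //; exact: le_trans yk.
- move=> x y [k kn xk] [l ln yl]; exists (k `|` l)%O; first exact: negativeU.
  by rewrite leUx (le_trans xk) ?(le_trans yl)// leU2 ?leUl ?leUr.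
Qed.

(** * Consistent prime filters *)

Record is_point P : Prop := {
  point_prime :> is_prime_filter P;
  point_consistent : forall a, P a -> ~ P (nneg a);
}.

(** If [P] contains both [a] and [~a], then (N3) puts every [b ∨ ~b] in [P], and primeness chooses a
    side. *)
Lemma prime_consistent_or_complete P : is_prime_filter P ->
  (forall a, P a -> ~ P (nneg a)) \/ (forall a, P a \/ P (nneg a)).
Proof.
move=> Pp; have [|nc] := pselect (forall a, P a -> ~ P (nneg a)); first by left.
right=> b; apply: (prime_or Pp); move: nc => /existsNP[a /not_implyP[Pa]].
move=> /contrapT Pna; apply: (filter_le Pp _ (nkleene a b)).
exact: (filterI Pp).
Qed.

(** Negation reverses the order, so the preimage of [P] under it is a prime ideal, whose complement
    is a prime filter. *)
Lemma dual_prime P : is_prime_filter P -> is_prime_filter [set a | ~ P (nneg a)].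
Proof.
move=> Pp; split=> /=; first split=> /=.
- by rewrite nneg1; exact: prime_proper.
- move=> x y nPx xy Py; apply: nPx; apply: (filter_le Pp Py).
  by rewrite -le_nneg.
- by move=> x y nPx nPy; rewrite nnegI => /(prime_or Pp)[].
- by rewrite nneg0; case; exact: (filter1 Pp).
- move=> x y nPxy; apply/not_andP => -[Px Py]; apply: nPxy.
  by rewrite nnegU; exact: (filterI Pp).
Qed.

(** A prime filter containing [a] but not [b] may be inconsistent. It is then complete, so its dual
    is a point, and this one contains [~b] but not [~a]. *)
Lemma point_separation a b : ~~ (a <= b) -> exists2 P, is_point P &
  (P a /\ ~ P b) \/ (P (nneg b) /\ ~ P (nneg a)).
Proof.
move=> ab.
have [|||P [Pp aP Pb]] := @prime_separation _ A [set x | a <= x] [set x | x <= b].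
- split=> [|x y /= ax xy|x y /= ax ay]; first exact: lex1.
    exact: le_trans xy.
  by rewrite lexI ax ay.
- split=> [|x y /= yb xy|x y /= xb yb]; first exact: le0x.
    exact: le_trans yb.
  by rewrite leUx xb yb.
- by rewrite -subset0 => x [/= ax xb]; move: ab; rewrite (le_trans ax xb).
have Pa : P a by apply: aP; exact: lexx.
have nPb : ~ P b.
  move=> Pb'; have : (P `&` [set x | x <= b]) b; last by rewrite Pb.
  by split => //; exact: lexx.
have [Pc|Pc] := prime_consistent_or_complete Pp; first by exists P; [split|left].
exists [set x | ~ P (nneg x)]; last first.
  by right; rewrite /= !nnegK; split=> // /(_ Pa).
split; first exact: dual_prime.
by move=> x /= nPx; rewrite nnegK; apply; have [] := Pc x.
Qed.

(** As in Kripke semantics, a counterexample point is needed when [P] misses [nimp a b]: it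
    separates the filter generated by [P] and [a] from the negative ideal of [b]. *)
Lemma point_nimp P a b : is_point P ->
  P (nimp a b) <-> (forall Q, is_point Q -> P `<=` Q -> Q a -> Q b).
Proof.
move=> Pp; split=> [Pab Q Qp PQ Qa|H].
  have /(prime_or Qp)[Qna|//] : Q (nneg a `|` b)%O.
    apply: (filter_le Qp _ (nimp_mp a b)).
    by apply: (filterI Qp) => //; exact: PQ.
  by case: (point_consistent Qp Qa).
apply: contrapT => nPab.
have [|||Q [Qp PQ Qb]] := @prime_separation _ A (adjoin P a) (negative_ideal b).
- exact/adjoin_filter/Pp.
- exact: negative_idealP.
- rewrite -subset0 => x [[p Pp' px] [k kn xbk]]; apply: nPab.
  have h := negative_absorb kn (le_trans px xbk).
  (* By (N4) and (N5), [h] gives [⊤ <= (p ∧ a) → b = p → (a → b)], hence [p <= ~p ∨ (a → b)];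
     consistency of [P] then excludes [~p]. *)
  have : P (nneg p `|` nimp a b)%O.
    apply: (filter_le Pp Pp').
    rewrite -[p in p <= _](meet_idPl (lex1 p)) nimpP -nimp_curry -nimpP.
    by rewrite meetx1.
  by case/(prime_or Pp) => // /(point_consistent Pp Pp').
have nQb k : k <= nneg k -> ~ Q (b `|` k)%O.
  move=> kn Qk; have : (Q `&` negative_ideal b) (b `|` k)%O.
    by split => //; exists k.
  by rewrite Qb.
have Qpt : is_point Q.
  split => // x Qx Qnx; apply: (nQb (x `&` nneg x)%O).
    by rewrite nnegI nnegK leIxl// leUr.
  by apply: (filter_le Qp _ (leUr _ _)); exact: (filterI Qp).
(* The negative element [\bot] shows that [b] itself is not in [Q]. *)
apply: (nQb \bot); first exact: le0x.
rewrite joinx0; apply: (H Q Qpt).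
  by apply: subset_trans PQ; exact: sub_adjoin.
exact/PQ/adjoin_mem/Pp.
Qed.

(** For the converse, [nimp_mp] is applied in the dual of [P], which contains [a] by consistency but
    contains neither [~a] nor [b]. *)
Lemma point_nneg_nimp P a b : is_point P ->
  P (nneg (nimp a b)) <-> P a /\ P (nneg b).
Proof.
move=> Pp; split=> [Pw|[Pa Pnb]].
  split; apply: (filter_le Pp Pw).
    by rewrite nneg_geC nneg_le_nimp.
  by rewrite -le_nneg le_nimp.
have Dp := dual_prime Pp.
apply: contrapT => nPw.
have /(prime_or Dp)[] := filter_le Dp
  (filterI Dp (point_consistent Pp Pa) nPw) (nimp_mp a b).
  by rewrite /= nnegK.
by [].
Qed.

(** * The quasiorder of points and the embedding *)

Definition point := ({P : set A | is_point P} * bool)%type.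

Definition point_rel (x : point) : set point :=
  [set y | sval x.1 `<=` sval y.1].

Lemma point_rel_trans (x y z : point) :
  point_rel x y -> point_rel y z -> point_rel x z.
Proof. exact: subset_trans. Qed.

Definition point_qo : quasiorder point :=
  @Quasiorder point point_rel (fun _ => @subset_refl _ _) point_rel_trans.

Definition rough_val a : set point * set point :=
  ([set x | sval x.1 a], [set x | ~ sval x.1 (nneg a)]).

Lemma rough_val_subproof a : `[< is_rough point_qo (rough_val a) >].
Proof.
apply/asboolP/is_roughP; split=> /=.
- by move=> x y xa; exact.
- by move=> x y nya xy xa; apply/nya/xy.
- by move=> [[P Pp] c] /=; exact: point_consistent.
(* The other copy of [P] is a second successor, so the singleton condition is vacuous. *)
- move=> [P c] /(_ (P, ~~ c) (@subset_refl _ _)) /= [].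
  by case: c.
Qed.

Definition rough_of a : RS point_qo := MkRS (rough_val_subproof a).

(** Joins and meets reduce to primeness, filter closure and De Morgan. For implication, [point_nimp]
    handles the lower component and [point_nneg_nimp] the upper one. *)
Lemma rough_of_morphism : nelson_morphism rough_of.
Proof.
split=> [||a b|a b|a|a b]; apply: rs_eq; apply/seteqP;
  split=> -[[P Pp] c] /=.
- exact: (prime_proper Pp).
- by [].
- by rewrite nneg0; case; exact: (filter1 Pp).
- by [].
- by [].
- by move=> _; exact: (filter1 Pp).
- by [].
- by move=> _; rewrite nneg1; exact: (prime_proper Pp).
- exact: (prime_or Pp).
- by move=> [Pa|Pb]; [exact: (filter_le Pp Pa (leUl _ _))
    |exact: (filter_le Pp Pb (leUr _ _))].
- move=> nP; apply/not_andP => -[Pa Pb]; apply: nP.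
  by rewrite nnegU; exact: (filterI Pp).
- rewrite nnegU => nP Pab; case: nP => nP; apply: nP.
    exact: (filter_le Pp Pab (leIl _ _)).
  exact: (filter_le Pp Pab (leIr _ _)).
- by move=> Pab; split; [exact: (filter_le Pp Pab (leIl _ _))
    |exact: (filter_le Pp Pab (leIr _ _))].
- by move=> [Pa Pb]; exact: (filterI Pp).
- rewrite nnegI => nP; split=> Pa; apply: nP.
    exact: (filter_le Pp Pa (leUl _ _)).
  exact: (filter_le Pp Pa (leUr _ _)).
- by rewrite nnegI => -[nPa nPb] /(prime_or Pp)[].
- by move=> Pa; apply.
- exact: contrapT.
- by rewrite nnegK.
- by rewrite nnegK.
- move=> /(point_nimp _ _ Pp) H [[Q Qp] e] /= PQ.
  by have [Qa|nQa] := pselect (Q a); [right; exact: H Qa|left].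
- move=> H; apply/(point_nimp _ _ Pp) => Q Qp PQ Qa.
  by case: (H (exist _ Q Qp, true) PQ).
- by move=> /(point_nneg_nimp _ _ Pp) /not_andP.
- by move=> nP /(point_nneg_nimp _ _ Pp)[Pa Pnb]; case: nP.
Qed.

(** The two alternatives of [point_separation] are differences in the lower and in the upper
    component respectively. *)
Lemma rough_of_inj : injective rough_of.
Proof.
suff h a b : rough_of a = rough_of b -> a <= b.
  by move=> a b e; apply/le_anti; rewrite !h.
move=> e; apply: contrapT => /negP /point_separation[P Pp].
pose x : point := (exist _ P Pp, true).
have /= e1 := congr1 (fun r => (rs_val r).1 x) e.
have /= e2 := congr1 (fun r => (rs_val r).2 x) e.
move=> [[Pa nPb]|[Pnb nPna]].
  by apply: nPb; rewrite -e1.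
by move: nPna; rewrite e2.
Qed.

End NelsonAlgebras.

(** * The image of the embedding as a subalgebra *)

Lemma nelson_morphism_range dA dB (A : nelsonType dA) (B : nelsonType dB)
    (f : A -> B) : nelson_morphism f -> nelson_subalgebra (range f).
Proof.
move=> [f0 f1 fU fI fN fimp]; split.
- by exists \bot.
- by exists \top.
- by move=> _ _ [a _ <-] [b _ <-]; exists (a `|` b)%O.
- by move=> _ _ [a _ <-] [b _ <-]; exists (a `&` b)%O.
- by move=> _ [a _ <-]; exists (nneg a).
- by move=> _ _ [a _ <-] [b _ <-]; exists (nimp a b).
Qed.

Theorem theorem2p2 (d : Order.disp_t) (A : nelsonType d) :
  exists (U : Type) (R : quasiorder U) (S : set (RS R)),
    nelson_subalgebra S /\ nelson_isomorphic_to_sub A S.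
Proof.
exists (@point d A), point_qo, (range rough_of); split.
  exact/nelson_morphism_range/rough_of_morphism.
exists rough_of; split; last exact: rough_of_morphism.
split; first by move=> a _; exists a.
  by move=> a b _ _; exact: rough_of_inj.
by move=> _ [a _ <-]; exists a.
Qed.
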